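(* If $E$ is a non-empty closed subset of $\mathbb{R}^d$, then $\dim_{qL}E\le\dim_HE$.
   Context: $\dim_H$ denotes Hausdorff dimension. $B(x,R)$ denotes the ball with centre $x$ and radius $R$, and $N_r(A)$ is the least number of balls of radius $r$ needed to cover a bounded set $A\subseteq\mathbb{R}^d$. For $0\le\delta<1$ let $\underline{h_E}(\delta)=\sup\{\alpha\ge0:\exists b,c>0$ such that $\min_{x\in E}N_r(E\cap B(x,R))\ge c(R/r)^\alpha$ for all $0<r\le R^{1+\delta}\le R\le b\}$. The quasi-lower Assouad dimension is $\dim_{qL}E=\lim_{\delta\to0}\underline{h_E}(\delta)$ (limit as $\delta\to0^+$ of a monotone function). *)

(* Defs.v *)
From HB Require Import structures.
From mathcomp Require Import all_boot all_order all_algebra.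
From mathcomp Require Import all_classical all_reals all_analysis.

Set Implicit Arguments.
Unset Strict Implicit.
Unset Printing Implicit Defensive.

Import Order.TTheory GRing.Theory Num.Theory.
Import numFieldNormedType.Exports.

Local Open Scope classical_set_scope.
Local Open Scope ring_scope.

Section Euclidean.
Context (R : realType) (d : nat).
Implicit Types (x y : 'rV[R]_d) (A E : set 'rV[R]_d) (r s delta : R).

(* The library's norm on 'rV[R]_d is the sup norm; balls and diameters here are
   Euclidean. Both norms induce the same topology. *)
Definition edist x y : R := Num.sqrt (\sum_i (x 0 i - y 0 i) ^+ 2).

Definition eball x r : set 'rV[R]_d := [set y | edist x y <= r].

Definition covered_by A r (n : nat) : Prop :=
  exists c : 'I_n -> 'rV[R]_d, A `<=` \bigcup_(i in setT) eball (c i) r.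

(* Extended-real valued, with value +oo when no finite cover exists; this does
   not occur for bounded A and r > 0, where the infimum is a minimum. *)
Definition covering_number r A : \bar R :=
  ereal_inf [set n%:R%:E | n in covered_by A r].

Definition lower_h E delta : \bar R :=
  ereal_sup [set alpha%:E | alpha in [set alpha : R | 0 <= alpha /\
    exists b c : R, [/\ 0 < b, 0 < c &
      forall r rho : R,
        0 < r -> r <= rho `^ (1 + delta) -> rho `^ (1 + delta) <= rho ->
        rho <= b ->
        ((c * (rho / r) `^ alpha)%:E <=
           ereal_inf [set covering_number r (E `&` eball x rho) | x in E])%E]]].

Definition dim_qL E : \bar R := lim (lower_h E delta @[delta --> 0^'+]).

Definition ediam A : \bar R :=
  ereal_sup [set (edist p.1 p.2)%:E | p in A `*` A].

(* The empty set contributes 0 also when s = 0, although 0 `^ 0 = 1. *)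
Definition diam_pow s A : \bar R :=
  if pselect (A = set0) then 0%E else (ediam A `^ s)%E.

Definition is_delta_cover delta E (U : nat -> set 'rV[R]_d) : Prop :=
  E `<=` \bigcup_i U i /\ forall i, (ediam (U i) <= delta%:E)%E.

Definition hausdorff_premeasure s delta E : \bar R :=
  ereal_inf [set (\sum_(0 <= i <oo) diam_pow s (U i))%E |
    U in is_delta_cover delta E].

(* The limit as delta -> 0+ is the supremum, by monotonicity. *)
Definition hausdorff_measure s E : \bar R :=
  ereal_sup [set hausdorff_premeasure s delta E |
    delta in [set delta : R | 0 < delta]].

Definition dim_H E : \bar R :=
  ereal_inf [set s%:E | s in [set s : R | 0 <= s /\
    hausdorff_measure s E = 0%E]].

End Euclidean.

(* Main.v *)
(* Let H^s(E) = 0 and suppose s < beta < dim_qL E. For a suitable q > 1 with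
   q s <= beta and every small x, each ball of radius x centred in E contains
   at least x^beta / (x^q)^beta points of E that are 4 x^q-separated and at
   distance at most x / 2 from the centre. Iterating over the radii
   rho_(k+1) = rho_k^q yields a tree of nested balls in which a ball of level k
   would carry mass at most m_k = rho_k^beta, up to a constant, and a set of
   diameter at most rho_k meets at most one ball of level k. A set of diameter
   u with rho_(k+1) < u <= rho_k then has mass at most
   m_k <= rho_(k+1)^s <= u^s. Instead of building the measure, an averaging
   argument applied to a cover with small sum of u^s selects, level by level, a
   child on which the total weight of the cover stays below 1; the intersection
   of the selected balls is a point of E outside the cover. *)

Require Import Defs.
From mathcomp Require Import all_boot all_order all_algebra.
From mathcomp Require Import all_classical all_reals all_analysis.
From mathcomp Require Import ring lra.
Import Order.TTheory GRing.Theory Num.Theory.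
Import numFieldNormedType.Exports.
(* Makes [edist] the Euclidean distance again: all_analysis has an [edist]. *)
Import Defs.

Local Open Scope classical_set_scope.
Local Open Scope ring_scope.

(** * Cauchy-Schwarz and Minkowski inequalities for finite sums *)

Lemma sum_mul_sqr_le (R : realDomainType) (I : finType) (a b : I -> R) :
  (\sum_i a i * b i) ^+ 2 <= (\sum_i a i ^+ 2) * (\sum_i b i ^+ 2).
Proof.
(* By Lagrange's identity, this double sum is twice the difference of the two sides. *)
have H : 0 <= \sum_i \sum_j (a i * b j - a j * b i) ^+ 2.
  by apply: sumr_ge0 => i _; apply: sumr_ge0 => j _; exact: sqr_ge0.
have E : \sum_i \sum_j (a i * b j - a j * b i) ^+ 2 =
    \sum_i \sum_j a i ^+ 2 * b j ^+ 2 + \sum_i \sum_j b i ^+ 2 * a j ^+ 2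
    - (\sum_i \sum_j (a i * b i) * (a j * b j)) *+ 2.
  rewrite -sumrMnl -big_split -sumrB/=; apply: eq_bigr => i _.
  rewrite -sumrMnl -big_split -sumrB/=; apply: eq_bigr => j _; ring.
move: H; rewrite E -!big_distrlr/= [X in _ + X - _]mulrC -mulr2n -mulrnBl.
by rewrite pmulrn_lge0// subr_ge0 expr2.
Qed.

Lemma sqrt_sum_sqrD_le (R : rcfType) (I : finType) (a b : I -> R) :
  Num.sqrt (\sum_i (a i + b i) ^+ 2) <=
  Num.sqrt (\sum_i a i ^+ 2) + Num.sqrt (\sum_i b i ^+ 2).
Proof.
have S0 (f : I -> R) : 0 <= \sum_i f i ^+ 2.
  by apply: sumr_ge0 => i _; exact: sqr_ge0.
rewrite -(ler_pXn2r (_ : 0 < 2)%N) ?nnegrE ?addr_ge0 ?sqrtr_ge0//.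
rewrite sqrrD !sqr_sqrtr//.
have -> : \sum_i (a i + b i) ^+ 2 =
    \sum_i a i ^+ 2 + (\sum_i a i * b i) *+ 2 + \sum_i b i ^+ 2.
  rewrite -sumrMnl -!big_split/=; apply: eq_bigr => i _; exact: sqrrD.
rewrite lerD2r lerD2l lerMn2r/=.
rewrite (le_trans (ler_norm _))// -sqrtrM// -sqrtr_sqr ler_sqrt ?mulr_ge0//.
exact: sum_mul_sqr_le.
Qed.

(** * Euclidean distance and nested closed balls *)

Section Euclidean_distance.
Context {R : realType} {d : nat}.
Implicit Types (x y z : 'rV[R]_d) (r : R).

Lemma edist_triangle y x z : edist x z <= edist x y + edist y z.
Proof.
rewrite /edist; under eq_bigr => i _ do rewrite -(subrKA (y 0 i) (x 0 i)).
exact: sqrt_sum_sqrD_le.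
Qed.

Lemma edistC x y : edist x y = edist y x.
Proof.
by rewrite /edist; congr Num.sqrt; apply: eq_bigr => i _; rewrite -sqrrN opprB.
Qed.

Lemma edistxx x : edist x x = 0.
Proof.
by rewrite /edist big1 ?sqrtr0// => i _; rewrite subrr expr0n.
Qed.

Lemma normrB_le_edist x y i : `|x 0 i - y 0 i| <= edist x y.
Proof.
rewrite -sqrtr_sqr ler_wsqrtr// (bigD1 i)//= lerDl.
by apply: sumr_ge0 => j _; exact: sqr_ge0.
Qed.

Lemma eball_subset x y (r s : R) :
  edist x y + s <= r -> eball y s `<=` eball x r.
Proof.
move=> xy z yz; rewrite /eball/=; apply: le_trans xy.
by rewrite (le_trans (edist_triangle y x z))// lerD2l.
Qed.

Lemma edist_lt_ball x (e : R) : 0 < e ->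
  forall y, edist x y < e -> ball x e y.
Proof.
move=> e0 y xy; split=> // i j.
rewrite ord1 /ball/=; exact: le_lt_trans (normrB_le_edist _ _ _) xy.
Qed.

Lemma continuous_edist x : continuous (edist x).
Proof.
have S (I : finType) (f : I -> 'rV[R]_d -> R) :
    (forall i, continuous (f i)) -> continuous (fun y => \sum_i f i y).
  move=> fc; rewrite -fct_sumE.
  apply: (big_ind (fun g : 'rV[R]_d -> R => continuous g)) => //.
    exact: (@cst_continuous _ _ (0 : R)).
  by move=> g h gc hc y; exact: (cvgD (gc y) (hc y)).
move=> y; apply: (@continuous_comp _ _ _ _ Num.sqrt); last first.
  exact: sqrt_continuous.
apply: S => i {}y.
apply: (@continuous_comp _ _ _ (fun z : 'rV[R]_d => x 0 i - z 0 i)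
  (fun u : R => u ^+ 2)); last exact: exprn_continuous.
by apply: continuousB; [exact: cst_continuous|exact: coord_continuous].
Qed.

Lemma closed_eball x r : closed (eball x r).
Proof.
apply: (@preimage_closed _ _ (edist x) [set s | s <= r]); last exact: closed_le.
by move=> y _; exact: continuous_edist.
Qed.

(** Nesting and small radii make the centres a Cauchy sequence, also in the sup norm; closedness of
    [E] and of each ball passes to the limit. *)
Lemma closed_nested_eballs (E : set 'rV[R]_d) (p : nat -> 'rV[R]_d)
    (rho : nat -> R) :
  closed E -> (forall k, E (p k)) -> (forall k, 0 <= rho k) ->
  (forall e, 0 < e -> exists k, rho k < e) ->
  (forall k, eball (p k.+1) (rho k.+1) `<=` eball (p k) (rho k)) ->
  exists2 x, E x & forall k, eball (p k) (rho k) x.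
Proof.
move=> Ecl Ep rho0 rhoe nest.
have {}nest k l : (k <= l)%N -> eball (p k) (rho k) (p l).
  move=> kl; have : eball (p l) (rho l) `<=` eball (p k) (rho k).
    elim: l kl => [|l ih]; first by rewrite leqn0 => /eqP ->.
    by rewrite leq_eqVlt => /predU1P[->//|/ih]; exact: subset_trans (nest l).
  by apply; rewrite /eball/= edistxx.
have pcvg : cvgn p.
  apply: cauchy_cvg; apply: cauchy_exP => e e0.
  have [k ke] := rhoe e e0; exists (p k).
  exists k => // l /= kl; apply: edist_lt_ball => //.
  exact: le_lt_trans (nest _ _ kl) ke.
exists (limn p).
  by apply: (closed_cvg E Ecl _ _ pcvg); apply: nearW.
move=> k; apply: (closed_cvg _ (closed_eball (p k) (rho k)) _ _ pcvg).
by exists k => // l /= kl; exact: nest.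
Qed.

End Euclidean_distance.

(** * From covering numbers to separated families *)

Section Separated_families.
Context {R : realType} {d : nat}.
Implicit Types (A E : set 'rV[R]_d) (r : R).

Definition separated {n} r (y : 'I_n -> 'rV[R]_d) :=
  forall i j, i != j -> r < edist (y i) (y j).

(** Greedy construction: if the balls around the points chosen so far do not cover [A], an uncovered
    point extends the family. *)
Lemma separated_or_covered A r n :
  (exists2 y : 'I_n -> 'rV[R]_d, forall i, A (y i) & separated r y) \/
  (exists2 m, (m < n)%N & covered_by A r m).
Proof.
elim: n => [|n ih]; first by left; exists (fun=> 0) => -[].
case: ih => [[y Ay ysep]|[m mn Am]]; last first.
  by right; exists m => //; exact: ltnW.
have [cov|/existsNP[z /not_implyP[Az zP]]] :=
    pselect (A `<=` \bigcup_(i in setT) eball (y i) r).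
  by right; exists n => //; exists y.
have zy i : r < edist (y i) z.
  by rewrite ltNge; apply/negP => yz; apply: zP; exists i.
left; exists (fun i => if unlift ord_max i is Some j then y j else z).
  by move=> i; case: unliftP.
move=> i j; case: unliftP => [i'|] ->; case: unliftP => [j'|] -> //.
- by rewrite (inj_eq lift_inj); exact: ysep.
- by rewrite edistC.
- by rewrite eqxx.
Qed.

(** With [n] the least integer at least [K], a cover by fewer than [n] balls would contradict the
    bound on the covering number. The argument also covers an infinite covering number. *)
Lemma separated_covering_number A r (K : R) :
  (K%:E <= covering_number r A)%E ->
  exists n (y : 'I_n -> 'rV[R]_d),
    [/\ K <= n%:R, forall i, A (y i) & separated r y].
Proof.
move=> KA.
have exn : exists n, K <= n%:R.
  exists (Num.bound `|K|).
  exact: ltW (le_lt_trans (ler_norm K) (archi_boundP (normr_ge0 K))).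
case: (ex_minnP exn) => n Kn nmin.
have [[y Ay ysep]|[m mn Am]] := separated_or_covered A r n.
  by exists n, y.
have : K <= m%:R.
  by rewrite -lee_fin (le_trans KA)//; apply: ereal_inf_lbound; exists m.
by move/nmin; rewrite leqNgt mn.
Qed.

Lemma separated_children E (alpha beta b c delta q : R) :
  0 < b -> 0 < c -> 0 < delta -> 1 + delta < q -> beta < alpha -> 0 <= alpha ->
  (forall r rho : R, 0 < r -> r <= rho `^ (1 + delta) ->
    rho `^ (1 + delta) <= rho -> rho <= b ->
    ((c * (rho / r) `^ alpha)%:E <=
      ereal_inf [set covering_number r (E `&` eball x rho) | x in E])%E) ->
  \forall x \near 0^'+, x `^ q <= x / 4 /\ forall p, E p ->
    exists n (y : 'I_n -> 'rV[R]_d),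
      [/\ forall i, E (y i) /\ edist p (y i) <= x / 2,
          separated (4 * x `^ q) y & x `^ beta <= n%:R * (x `^ q) `^ beta].
Proof.
move=> b0 c0 delta0 deltaq ba a0 EP.
(* The bound is applied at the radii [x / 2] and [4 * x ^ q]. The constant [k] makes them an
   admissible pair; [l] is what remains of the lower bound after extracting [x ^ ((1 - q) * alpha)],
   and the gap between [beta] and [alpha] absorbs it. *)
pose k : R := 2^-1 `^ (1 + delta) / 4.
pose l : R := c * 8^-1 `^ alpha.
have k0 : 0 < k by rewrite divr_gt0// powR_gt0// invr_gt0.
have l0 : 0 < l by rewrite mulr_gt0// powR_gt0// invr_gt0.
have small (e K : R) : 0 < e -> 0 < K -> \forall x \near 0^'+, x `^ e <= K.
  move=> e0 K0; near=> x; apply: ltW; near: x.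
  exact: (cvgr_lt 0 (powR_cvg0 e0)).
near=> x.
have x0 : 0 < x by [].
have x1 : x <= 1 by near: x; exact: nbhs_right_le.
have xb : x / 2 <= b.
  rewrite ler_pdivrMr//; near: x; apply: nbhs_right_le; exact: mulr_gt0.
have xk : x `^ (q - 1 - delta) <= k.
  near: x; apply: small => //; lra.
have xl : x `^ ((q - 1) * (alpha - beta)) <= l.
  near: x; apply: small => //; apply: mulr_gt0; lra.
have xn0 : x != 0 by rewrite gt_eqF.
have q0 : 0 < x `^ q by exact: powR_gt0.
have rrho : 4 * x `^ q <= (x / 2) `^ (1 + delta).
  have -> : q = (1 + delta) + (q - 1 - delta) by lra.
  rewrite powRD ?xn0 ?implybT// powRM ?invr_ge0 ?(ltW x0)//.
  by rewrite mulrCA ler_wpM2l ?powR_ge0// mulrC -ler_pdivlMr.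
have rho1 : (x / 2) `^ (1 + delta) <= x / 2.
  apply: ge1r_powR; lra.
split; first by lra.
move=> p Ep.
have r0 : 0 < 4 * x `^ q by exact: mulr_gt0.
have := EP _ _ r0 rrho rho1 xb.
move=> /le_trans/(_ (ereal_inf_lbound _)).
move=> /(_ (covering_number (4 * x `^ q) (E `&` eball p (x / 2)))).
move=> /(_ (ex_intro2 _ _ p Ep erefl)) /separated_covering_number.
move=> [n [y [Kn Ay ysep]]].
exists n, y; split => //.
rewrite -ler_pdivrMr ?powR_gt0//; apply: le_trans Kn.
have -> : x / 2 / (4 * x `^ q) = 8^-1 * x `^ (1 - q).
  rewrite powRB ?xn0 ?implybT// powRr1 ?(ltW x0)//; field; lra.
rewrite powRM ?powR_ge0 ?invr_ge0// -!powRrM mulrA -/l -powRB ?xn0 ?implybT//.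
have -> : beta - q * beta = (q - 1) * (alpha - beta) + (1 - q) * alpha by ring.
by rewrite powRD ?xn0 ?implybT// ler_wpM2r ?powR_ge0.
Unshelve. all: by end_near. Qed.

End Separated_families.

(** * Averaging over the tree of balls *)

Section Escaping_a_cover.
Context {R : realType} {d : nat} (rho m : nat -> R) (U : nat -> set 'rV[R]_d)
  (lvl : nat -> nat).
Hypothesis rho_gt0 : forall k, 0 < rho k.
Hypothesis m_gt0 : forall k, 0 < m k.
Hypothesis rho_shrink : forall k, rho k.+1 <= rho k / 4.
Hypothesis small_U :
  forall i x y, U i x -> U i y -> edist x y <= rho (lvl i).

Definition hit (i k : nat) (p : 'rV[R]_d) : bool :=
  `[< U i `&` eball p (rho k) !=set0 >].

(* An upper bound for the proportion of the mass of [eball p (rho k)] carried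
   by [U i], for a mass distribution giving at most [m l] to each ball of level
   [l]: the set [U i] meets at most one ball of level [lvl i]. *)
Definition weight (i k : nat) (p : 'rV[R]_d) : R :=
  if hit i k p then m (maxn k (lvl i)) / m k else 0.

Lemma weight_ge0 i k p : 0 <= weight i k p.
Proof. by rewrite /weight; case: ifP => // _; rewrite divr_ge0// ltW. Qed.

Lemma rho_nonincreasing k l : (k <= l)%N -> rho l <= rho k.
Proof.
elim: l => [|l ih]; first by rewrite leqn0 => /eqP ->.
rewrite leq_eqVlt => /predU1P[->//|/ih]; apply: le_trans.
apply: le_trans (rho_shrink l) _.
by rewrite ler_pdivrMr// ler_peMr ?ler1n// ltW.
Qed.

Lemma child_subset k (p y : 'rV[R]_d) : edist p y <= rho k / 2 ->
  eball y (rho k.+1) `<=` eball p (rho k).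
Proof.
move=> py; apply: eball_subset.
by have := rho_gt0 k; have := rho_shrink k; lra.
Qed.

(** If [lvl i <= k], a hit parent has weight 1 and each child at most 1. Otherwise at most one child
    is hit, and the growth of its weight by [m k / m k.+1] is paid for by the number of children. *)
Lemma sum_weight_children i k p n (y : 'I_n -> 'rV[R]_d) :
  (forall j, edist p (y j) <= rho k / 2) -> separated (4 * rho k.+1) y ->
  m k <= n%:R * m k.+1 ->
  \sum_j weight i k.+1 (y j) <= n%:R * weight i k p.
Proof.
move=> py ysep mn.
have [[j0 hj0]|/forallNP nohit] := pselect (exists j, hit i k.+1 (y j));
  last first.
  rewrite big1 ?mulr_ge0 ?weight_ge0// => j _.
  by rewrite /weight ifF//; apply/negP/nohit.
have hp : hit i k p.
  apply/asboolP; move/asboolP : hj0 => [z [Uz yz]]; exists z; split => //.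
  exact: child_subset yz.
rewrite [X in _ <= _ * X]/weight hp; have [ik|ki] := leqP (lvl i) k.
  rewrite divff ?gt_eqF// mulr1.
  apply: (@le_trans _ _ (\sum_(j < n) 1)).
    apply: ler_sum => j _; rewrite /weight; case: ifP => // _.
    by rewrite (maxn_idPl (leqW ik)) divff// gt_eqF.
  by rewrite sumr_const card_ord.
rewrite (bigD1 j0)//= big1 ?addr0.
  rewrite /weight hj0 (maxn_idPr ki).
  rewrite mulrCA ler_wpM2l ?(ltW (m_gt0 _))//.
  by rewrite ler_pdivlMr// mulrC ler_pdivrMr.
(* Two hit children would have centres within [2 * rho k.+1 + rho (lvl i)], hence within
   [3 * rho k.+1]. *)
move=> j jj0; rewrite /weight ifF//; apply/negP => /asboolP[z [Uz yz]].
move/asboolP : hj0 => [z0 [Uz0 yz0]].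
have := ysep _ _ jj0; rewrite ltNge => /negP; apply.
have := small_U _ _ _ Uz Uz0; have := rho_nonincreasing _ _ ki; move: yz yz0.
rewrite /eball/= [edist (y j0) _]edistC => yz yz0 rk zz0.
have := edist_triangle z (y j) (y j0); have := edist_triangle z0 z (y j0).
by have := rho_gt0 k.+1; lra.
Qed.

Definition total_weight k p : \bar R := (\sum_(0 <= i <oo) (weight i k p)%:E)%E.

(** If every child had total weight at least 1, summing over the children would give
    [n <= n * total_weight k p]. *)
Lemma exists_light_child k p n (y : 'I_n -> 'rV[R]_d) :
  (forall j, edist p (y j) <= rho k / 2) -> separated (4 * rho k.+1) y ->
  m k <= n%:R * m k.+1 -> (total_weight k p < 1)%E ->
  exists j, (total_weight k.+1 (y j) < 1)%E.
Proof.
move=> py ysep mn Wp; apply: contrapT => /forallNP noj.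
have n0 : 0 < n%:R :> R.
  by rewrite -(pmulr_lgt0 _ (m_gt0 k.+1)); exact: lt_le_trans mn.
have : (n%:R%:E <= n%:R%:E * total_weight k p)%E.
  rewrite -nneseriesZl => [|i _]; last by rewrite lee_fin weight_ge0.
  apply: (@le_trans _ _ (\sum_(j < n) total_weight k.+1 (y j))%E).
    apply: (@le_trans _ _ (\sum_(j < n) 1)%E).
      by rewrite sumEFin lee_fin sumr_const card_ord.
    by apply: lee_sum => j _; rewrite leNgt; apply/negP/noj.
  rewrite -nneseries_sum => [|i j _]; last by rewrite lee_fin weight_ge0.
  apply: lee_nneseries => [i _ _|i _].
    by apply: sume_ge0 => j _; rewrite lee_fin weight_ge0.
  by rewrite sumEFin -EFinM lee_fin; exact: sum_weight_children.
rewrite leNgt => /negP; apply.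
by rewrite -[ltRHS]mule1 lte_pmul2l// lte_fin.
Qed.

Lemma exists_not_covered (E : set 'rV[R]_d) : closed E -> E !=set0 ->
  (forall k p, E p -> exists n (y : 'I_n -> 'rV[R]_d),
    [/\ forall j, E (y j) /\ edist p (y j) <= rho k / 2,
        separated (4 * rho k.+1) y & m k <= n%:R * m k.+1]) ->
  (forall e, 0 < e -> exists k, rho k < e) ->
  (\sum_(0 <= i <oo) (m (lvl i))%:E < (m 0)%:E)%E ->
  exists2 x, E x & ~ (\bigcup_i U i) x.
Proof.
move=> Ecl [p0 Ep0] children rhoe Um.
pose light k p := E p /\ (total_weight k p < 1)%E.
have light0 : light 0%N p0.
  split=> //.
  apply: (@le_lt_trans _ _
    ((m 0)^-1%:E * \sum_(0 <= i <oo) (m (lvl i))%:E)%E).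
    rewrite -nneseriesZl => [|i _]; last by rewrite lee_fin ltW.
    apply: lee_nneseries => [i _ _|i _]; first by rewrite lee_fin weight_ge0.
    rewrite -EFinM lee_fin mulrC /weight max0n.
    by case: ifP => // _; rewrite divr_ge0// ltW.
  have -> : (1 = (m 0)^-1%:E * (m 0)%:E :> \bar R)%E.
    by rewrite -EFinM mulVf// gt_eqF.
  by rewrite lte_pmul2l// lte_fin invr_gt0.
(* The choice function is total on pairs of a level and a point; at a pair that is not light it may
   return the point itself. *)
have [f fP] : {f : nat * 'rV[R]_d -> 'rV[R]_d & forall kp, light kp.1 kp.2 ->
    light kp.1.+1 (f kp) /\ edist kp.2 (f kp) <= rho kp.1 / 2}.
  apply: (@choice _ _ (fun kp q => light kp.1 kp.2 ->
    light kp.1.+1 q /\ edist kp.2 q <= rho kp.1 / 2)) => -[k p] /=.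
  have [[Ep Wp]|?] := pselect (light k p); last by exists p.
  have [n [y [yP ysep mn]]] := children k p Ep.
  have [j Wj] := exists_light_child _ _ _ _ (fun j => (yP j).2) ysep mn Wp.
  by exists (y j) => _; split; [split; [exact: (yP j).1|]|exact: (yP j).2].
pose p := nat_rect _ p0 (fun k q => f (k, q)).
have plight k : light k (p k).
  by elim: k => [//|k ih]; exact: (fP (k, p k) ih).1.
have [||x Ex px] :=
  @closed_nested_eballs _ _ E p rho Ecl (fun k => (plight k).1) _ rhoe.
- by move=> k; exact: ltW.
- by move=> k; apply: child_subset; exact: (fP (k, p k) (plight k)).2.
exists x => // -[i _ Ux].
(* The ball of level [lvl i] contains [x], a point of [U i], so this set alone contributes weight 1
   there. *)
have := (plight (lvl i)).2; rewrite ltNge => /negP; apply.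
rewrite /total_weight (@nneseriesD1 _ _ i xpredT)//; last first.
  by move=> j _; rewrite lee_fin weight_ge0.
apply: (@le_trans _ _ (weight i (lvl i) (p (lvl i)))%:E).
  rewrite lee_fin /weight maxnn divff ?gt_eqF//.
  by rewrite ifT//; apply/asboolP; exists x.
by rewrite leeDl// nneseries_ge0// => j _ _; rewrite lee_fin weight_ge0.
Qed.

End Escaping_a_cover.

(** * Monotonicity of [lower_h] and the level of a covering set *)

Section Dimensions.
Context {R : realType} {d : nat}.
Implicit Types (A E : set 'rV[R]_d).

Lemma powR_succ_le_id_le1 (x delta : R) :
  0 < x -> 0 < delta -> x `^ (1 + delta) <= x -> x <= 1.
Proof.
move=> x0 delta0 xle.
have : ln (x `^ (1 + delta)) <= ln x by rewrite ler_ln ?posrE ?powR_gt0.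
by rewrite ln_powR mulrDl mul1r gerDl pmulr_rle0// -ln1 ler_ln ?posrE.
Qed.

(** A larger exponent admits fewer pairs of radii, because the constraints force [rho <= 1]. *)
Lemma lower_h_nondecreasing E (delta delta' : R) : 0 < delta ->
  delta <= delta' -> (lower_h E delta <= lower_h E delta')%E.
Proof.
move=> delta0 dd; apply: ereal_sup_le => _ [alpha [a0 [b [c [b0 c0 EP]]]] <-].
exists alpha => //; split=> //; exists b, c; split=> //.
move=> r rho r0 rrho rho1 rhob.
have rho0 : 0 < rho by rewrite (lt_le_trans r0)// (le_trans rrho).
have le1 : rho <= 1.
  exact: (powR_succ_le_id_le1 _ _ rho0 (lt_le_trans delta0 dd) rho1).
apply: EP => //.
  by apply: le_trans rrho _; apply: ger_powR; rewrite ?rho0// lerD2l.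
by apply: ge1r_powR; rewrite ?rho0// lerDl ltW.
Qed.

Lemma dim_qL_le_lower_h E (delta : R) : 0 < delta ->
  (dim_qL E <= lower_h E delta)%E.
Proof.
move=> delta0.
have nd : {in `]0, +oo[ &, nondecreasing_fun (lower_h E)}.
  move=> x y; rewrite in_itv/= andbT => x0 _; exact: lower_h_nondecreasing.
have /cvg_lim := @nondecreasing_at_right_cvge _ _ 0 +oo%O isT nd.
move=> lE; rewrite /dim_qL lE//; apply: ereal_inf_lbound.
by exists delta => //=; rewrite in_itv/= delta0.
Qed.

Lemma ediam_ge0 A : A !=set0 -> (0 <= ediam A)%E.
Proof.
move=> [x Ax]; apply: ereal_sup_ubound; exists (x, x) => //=.
by rewrite edistxx.
Qed.

Lemma edist_le_ediam A x y : A x -> A y -> ((edist x y)%:E <= ediam A)%E.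
Proof. by move=> Ax Ay; apply: ereal_sup_ubound; exists (x, y). Qed.

Lemma diam_pow_ge0 s A : (0 <= diam_pow s A)%E.
Proof.
by rewrite /diam_pow; case: pselect => //= _; exact: poweR_ge0.
Qed.

(** The term [eta] pays for sets that are empty or of diameter 0: no level matches their diameter,
    so a deep one is taken. *)
Lemma exists_level (rho : nat -> R) (beta q s : R) A (eta : R) :
  (forall k, 0 < rho k <= 1) -> (forall k, rho k.+1 = rho k `^ q) ->
  (forall e, 0 < e -> exists k, forall l, (k <= l)%N -> rho l < e) ->
  0 <= s -> 0 < beta -> q * s <= beta -> 0 < eta ->
  (ediam A <= (rho 0%N)%:E)%E ->
  exists k, (forall x y, A x -> A y -> edist x y <= rho k) /\
    ((rho k `^ beta)%:E <= diam_pow s A + eta%:E)%E.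
Proof.
move=> rho01 rhoS rhoe s0 beta0 qs eta0 A0.
have [k0 k0P] : exists k, forall l, (k <= l)%N -> rho l `^ beta <= eta.
  have [|k kP] := rhoe (eta `^ beta^-1); first exact: powR_gt0.
  exists k => l kl; have /andP[rl0 _] := rho01 l.
  have -> : eta = (eta `^ beta^-1) `^ beta.
    by rewrite -powRrM mulVf ?gt_eqF// powRr1// ltW.
  by rewrite ge0_ler_powR ?nnegrE ?powR_ge0// ltW// kP.
have D0 := diam_pow_ge0 s A.
have [AE|/eqP/set0P An] := pselect (A = set0).
  exists k0; split; first by rewrite AE.
  by apply: le_trans (leeDr _ D0); rewrite lee_fin k0P.
have [u uE] : exists u, ediam A = u%:E.
  by move: A0 (ediam_ge0 _ An); case: (ediam A) => // u; exists u.
have Au x y : A x -> A y -> edist x y <= u.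
  by move=> Ax Ay; rewrite -lee_fin -uE; exact: edist_le_ediam.
have u0 : 0 <= u by rewrite -lee_fin -uE ediam_ge0.
have [exk|/forallNP nok] := pselect (exists k, rho k.+1 < u); last first.
  exists k0.+1; split.
    move=> x y Ax Ay; apply: le_trans (Au _ _ Ax Ay) _.
    by rewrite leNgt; exact/negP.
  by apply: le_trans (leeDr _ D0); rewrite lee_fin k0P.
(* Minimality gives [u <= rho k]; for [k = 0] this is the assumption on the diameter. *)
case: (ex_minnP exk) => k ku kmin; exists k; split.
  move=> x y Ax Ay; apply: le_trans (Au _ _ Ax Ay) _.
  case: k ku kmin => [|k] _ kmin; first by rewrite -lee_fin -uE.
  by rewrite leNgt; apply/negP => /kmin; rewrite ltnn.
have etaE : (0 <= eta%:E)%E by rewrite lee_fin ltW.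
apply: le_trans (leeDl _ etaE).
rewrite /diam_pow; case: pselect => [A0'|An'] /=.
  by case/set0P/eqP : An.
rewrite uE poweR_EFin lee_fin (@le_trans _ _ (rho k.+1 `^ s))//.
  by rewrite rhoS -powRrM ger_powR.
by rewrite ge0_ler_powR ?nnegrE// ?(ltW ku)//; have /andP[/ltW] := rho01 k.+1.
Qed.

Lemma lt_EFin_between (s : R) (x : \bar R) : (s%:E < x)%E ->
  exists2 t : R, s < t & (t%:E < x)%E.
Proof.
case: x => [x| |] //; rewrite ?lte_fin => sx.
  by exists ((s + x) / 2); rewrite ?lte_fin; lra.
by exists (s + 1); rewrite ?ltry// ltrDl.
Qed.

End Dimensions.

(** * Choice of the parameters and conclusion *)

Theorem proposition10 (R : realType) (d : nat) (E : set 'rV[R]_d)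
  (E_nonempty : E !=set0) (E_closed : closed E) :
  (dim_qL E <= dim_H E)%E.
Proof.
apply: le_ereal_inf_tmp => _ [s [s0 Hs] <-]; rewrite leNgt; apply/negP.
move=> /lt_EFin_between[beta sbeta betaE].
have beta0 : 0 < beta by exact: le_lt_trans s0 sbeta.
(* This choice gives [q * s = beta - e], also for [s = 0], and leaves room for the exponent
   [1 + e / 2] below [q]. *)
pose e := (beta - s) / (s + 1); pose q := 1 + e.
have s1 : 0 < s + 1 by rewrite ltr_wpDl.
have e0 : 0 < e by rewrite divr_gt0// subr_gt0.
have e20 : 0 < e / 2 by rewrite divr_gt0.
have qs : q * s <= beta.
  have : e * (s + 1) = beta - s by rewrite divfK// gt_eqF.
  by rewrite /q; lra.
have /ereal_sup_gt[_ [alpha [alpha0 [b [c [b0 c0 EP]]]] <-]] :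
    (beta%:E < lower_h E (e / 2))%E.
  by apply: lt_le_trans betaE (dim_qL_le_lower_h _ _ e20).
rewrite lte_fin => ba.
have e2q : 1 + e / 2 < q by rewrite /q; lra.
have [r0 /= r0_gt0 scale] := iffLR (nbhs_ballP (0 : R) _)
  (filterI (nbhs_right_le (@ltr01 R))
    (separated_children E alpha beta b c (e / 2) q b0 c0 e20 e2q ba alpha0 EP)).
have ballx x : 0 < x -> x < r0 -> ball (0 : R) r0 x.
  by move=> x0 xr; rewrite /ball/= sub0r normrN gtr0_norm.
have {ballx}scale x (x0 : 0 < x) (xr : x < r0) := scale x (ballx x x0 xr) x0.
pose rho k := iter k (fun x => x `^ q) (r0 / 2).
have rhoP k : 0 < rho k < r0.
  elim: k => [|k /andP[rk0 rkr]] /=; first by apply/andP; split; lra.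
  have [_ [xq _]] := scale _ rk0 rkr.
  by rewrite powR_gt0//= (le_lt_trans xq)//; lra.
have rho_gt0 k : 0 < rho k by have /andP[] := rhoP k.
have {}scale k := scale _ (rho_gt0 k) (proj2 (andP (rhoP k))).
have rho_shrink k : rho k.+1 <= rho k / 4 by exact: (scale k).2.1.
have rhoe eps : 0 < eps -> exists k, forall l, (k <= l)%N -> rho l < eps.
  move=> eps0; have [k _ kP] := near_infty_natSinv_expn_lt (PosNum eps0).
  exists k => l kl; apply: le_lt_trans (kP l kl).
  rewrite div1r -exprVn; elim: l {kl} => [|l ih]; first exact: (scale 0%N).1.
  by rewrite exprS; have := rho_shrink l; have := rho_gt0 l; lra.
pose m k := rho k `^ beta.
have m_gt0 k : 0 < m k by exact: powR_gt0.
(* Half of [m 0] bounds the cover sum; the other half is shared among the errors [eta] of the sets,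
   as a geometric series. *)
have [U [EU Usmall] Usum] : exists2 U, is_delta_cover (rho 0%N) E U &
    (\sum_(0 <= i <oo) diam_pow s (U i) < (m 0%N / 2)%:E)%E.
  have : (hausdorff_premeasure s (rho 0%N) E < (m 0%N / 2)%:E)%E.
    apply: (@le_lt_trans _ _ 0%E); last by rewrite lte_fin divr_gt0.
    rewrite -Hs /hausdorff_measure; apply: ereal_sup_ubound.
    by exists (rho 0%N) => //; exact: rho_gt0.
  by move=> /ereal_inf_lt[_ [U UE <-] UM]; exists U.
have eta_gt0 i : 0 < m 0%N / 2 / (2 ^ i.+1)%:R.
  by rewrite !divr_gt0// ltr0n expn_gt0.
have /choice[lvl lvlP] i : exists k,
    (forall x y, U i x -> U i y -> edist x y <= rho k) /\
    ((m k)%:E <= diam_pow s (U i) + (m 0%N / 2 / (2 ^ i.+1)%:R)%:E)%E.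
  apply: (exists_level rho beta q s) => // k.
  by rewrite rho_gt0 (scale k).1.
have [||x Ex] := exists_not_covered rho m U lvl rho_gt0 m_gt0 rho_shrink
    (fun i => (lvlP i).1) E E_closed E_nonempty (fun k => (scale k).2.2).
- by move=> eps /rhoe[k kP]; exists k; exact: kP.
- apply: (@le_lt_trans _ _ (\sum_(0 <= i <oo) (diam_pow s (U i) +
      (m 0%N / 2 / (2 ^ i.+1)%:R)%:E))%E).
    apply: lee_nneseries => [i _ _|i _]; first by rewrite lee_fin ltW.
    exact: (lvlP i).2.
  apply: le_lt_trans (epsilon_trick _ (fun i => diam_pow_ge0 _ _) _) _.
    by rewrite divr_ge0// ltW.
  by rewrite [X in (_ < X%:E)%E]splitr EFinD lte_leD// lee_fin.
by move=> []; exact: EU.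
Qed.
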